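(* Let $\mathcal{A}$ be a unital prime $*$-ring with unit $I$. Assume that $\mathcal{A}$ contains a nontrivial symmetric idempotent $P$, and let $\Phi:\mathcal{A}\to\mathcal{A}$ be a surjective map (not assumed additive). If $\Phi$ is strong skew commutativity preserving, that is, $\Phi(A)\Phi(B)-\Phi(B)\Phi(A)^*=AB-BA^*$ for all $A,B\in\mathcal{A}$, then there exists a map $f:\mathcal{A}\to\mathcal{Z}_S(\mathcal{A})$ such that either $\Phi(A)=A+f(A)$ for all $A\in\mathcal{A}$, or $\Phi(A)=-A+f(A)$ for all $A\in\mathcal{A}$.
   Context: A $*$-ring is an associative ring with an involution $*$ (an additive map with $(AB)^*=B^*A^*$ and $A^{**}=A$). A ring $\mathcal{A}$ is prime if for any $A,B\in\mathcal{A}$, $A\mathcal{A}B=0$ implies $A=0$ or $B=0$. An element $A$ is symmetric if $A^*=A$. A nontrivial symmetric idempotent is an element $P$ with $P=P^2=P^*$ and $P\neq 0$, $P\neq I$. $\mathcal{Z}(\mathcal{A})$ denotes the center of $\mathcal{A}$ and $\mathcal{Z}_S(\mathcal{A})=\{A\in\mathcal{Z}(\mathcal{A}): A=A^*\}$. *)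

(* Defs.v *)
From HB Require Import structures.
From mathcomp Require Import all_boot all_order all_algebra.

Set Implicit Arguments.
Unset Strict Implicit.
Unset Printing Implicit Defensive.

Import GRing.Theory.

Local Open Scope ring_scope.

HB.mixin Record hasRingInvolution R of GRing.PzRing R := {
  star : R -> R;
  starD : {morph star : x y / x + y};
  starM : forall x y : R, star (x * y) = star y * star x;
  starK : involutive star
}.

#[short(type="starRingType")]
HB.structure Definition StarRing :=
  {R of GRing.PzRing R & hasRingInvolution R}.

Definition prime_ring (R : pzRingType) : Prop :=
  forall a b : R, (forall x : R, a * x * b = 0) -> a = 0 \/ b = 0.

Definition nontrivial_symmetric_idempotent (R : starRingType) (p : R) : Prop :=
  [/\ p * p = p, star p = p, p <> 0 & p <> 1].

Definition central (R : pzRingType) (z : R) : Prop :=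
  forall x : R, GRing.comm z x.

Definition central_symmetric (R : starRingType) (z : R) : Prop :=
  central z /\ star z = z.

Definition skew_commutator (R : starRingType) (a b : R) : R :=
  a * b - b * star a.

Definition strong_skew_commutativity_preserving
    (R : starRingType) (Phi : R -> R) : Prop :=
  forall a b : R, skew_commutator (Phi a) (Phi b) = skew_commutator a b.

(* Main.v *)
Require Import Defs.
From mathcomp Require Import all_boot all_order all_algebra.

Set Implicit Arguments.
Unset Strict Implicit.
Unset Printing Implicit Defensive.

Import GRing.Theory.

Local Open Scope ring_scope.

(** Write [[a, b] = a b - b a] and [K a = a - a^*], so that the skew commutator
    of [a] and [b] is [[a, b] + b K a].  The goal is to show that [Phi] differs
    from multiplication by a central [v] with [v^2 = 1] only by central
    symmetric elements; in a prime ring such a [v] is [1] or [-1].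

    The element [v] is a preimage of [1].  Comparing skew commutators with [1]
    in either slot shows that [v] is central and symmetric and that
    [K (Phi a) = v K a] ([preimage_of_one]).  Substituting this in the
    hypothesis gives
      [[Phi a, Phi b] - [a, b] = (b - v Phi b) K a].
    The left-hand side changes sign when [a] and [b] are exchanged, hence so
    does the right-hand side.  For a symmetric [s] we have [K s = 0], so
    [s - v Phi s] annihilates every [K a].  Because a noncentral symmetric
    element exists, namely [P], only [0] does so
    ([left_annihilator_of_skew_eq0]), whence [v Phi s = s].

    The identity above then says that [[Phi a, s] = v [a, s]] for all [a] and
    all symmetric [s].  Taking [a] symmetric gives [(v^2 - 1) [a, s] = 0], and
    symmetric elements do not all commute, so [v^2 = 1].  Moreover
    [Phi a - v a] commutes with every symmetric element, hence is central
    ([commutes_symmetric_central]), and it is symmetric because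
    [K (Phi a) = v K a]. *)

Definition commutator (R : pzRingType) (a b : R) : R := a * b - b * a.

Lemma commutatorMr (R : pzRingType) (a b c : R) :
  commutator a (b * c) = commutator a b * c + b * commutator a c.
Proof.
by rewrite /commutator mulrBl mulrBr !mulrA addrA subrK.
Qed.

Lemma commutatorC (R : pzRingType) (a b : R) :
  commutator a b = - commutator b a.
Proof. by rewrite /commutator opprB. Qed.

Lemma commutator_eq0 (R : pzRingType) (a b : R) :
  commutator a b = 0 <-> GRing.comm a b.
Proof. by split=> [/subr0_eq | cab] //; apply/eqP; rewrite subr_eq0 cab. Qed.

Lemma central_mul_eq0 (R : pzRingType) (z a : R) :
  prime_ring R -> central z -> z * a = 0 -> z = 0 \/ a = 0.
Proof.
by move=> R_prime cz za0; apply: R_prime => x; rewrite cz -mulrA za0 mulr0.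
Qed.

Lemma central_sqr_eq1 (R : pzRingType) (v : R) :
  prime_ring R -> central v -> v * v = 1 -> v = 1 \/ v = -1.
Proof.
move=> R_prime cv vv1.
have cv1 : central (v - 1).
  by move=> x; rewrite /GRing.comm mulrBl mulrBr mul1r mulr1 cv.
have : (v - 1) * (v + 1) = 0.
  by rewrite mulrDr mulr1 mulrBl mul1r vv1 addrA subrK subrr.
case/(central_mul_eq0 R_prime cv1) => [/subr0_eq | /eqP]; first by left.
by rewrite addr_eq0 => /eqP; right.
Qed.

(** A central idempotent [p] would satisfy [p x (1 - p) = 0] for all [x]. *)
Lemma nontrivial_idempotent_not_central (R : pzRingType) (p : R) :
  prime_ring R -> p * p = p -> p <> 0 -> p <> 1 -> ~ central p.
Proof.
move=> R_prime pp p0 p1 cp.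
have [|/p0 //|/subr0_eq/esym/p1 //] := R_prime p (1 - p).
by move=> x; rewrite cp -mulrA mulrBr mulr1 pp subrr mulr0.
Qed.

(** The Leibniz rule turns [x [b, c e] = 0] into [x c [b, e] = 0], to which
    primeness applies. *)
Lemma left_annihilator_of_commutators_eq0 (R : pzRingType) (b x : R) :
  prime_ring R -> ~ central b -> (forall c, x * commutator b c = 0) -> x = 0.
Proof.
move=> R_prime ncb xb0; have [//|x_neq0] := eqVneq x 0.
case: ncb => e; apply/commutator_eq0.
have [c | x0 | //] := R_prime x (commutator b e).
  by have := xb0 (c * e); rewrite commutatorMr mulrDr !mulrA xb0 mul0r add0r.
by rewrite x0 eqxx in x_neq0.
Qed.

(** Let [delta = [d, -]].  Since [d] commutes with [x + x^*], we have
    [delta (star x) = - delta x]; applied to [p x] this shows that every [delta x]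
    commutes with [p], so all Peirce corners [p (delta x) (1 - p)] vanish.
    As [delta] is a derivation killing [p], this makes [delta] vanish on
    [p x (1 - p)], and then primeness, used twice, kills [delta y * p] and
    finally [delta y]. *)
Lemma commutes_symmetric_central (R : starRingType) (p d : R) :
  prime_ring R -> nontrivial_symmetric_idempotent p ->
  (forall s : R, star s = s -> GRing.comm d s) -> central d.
Proof.
move=> R_prime [pp sp p0 p1] ds.
pose delta x := commutator d x.
have deltaM x y : delta (x * y) = delta x * y + x * delta y.
  exact: commutatorMr.
have delta_p : delta p = 0 by apply/commutator_eq0/ds.
have delta_star x : delta (star x) = - delta x.
  have /commutator_eq0 : GRing.comm d (x + star x).
    by apply: ds; rewrite starD starK addrC.
  rewrite /commutator mulrDr mulrDl opprD addrACA => /eqP.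
  by rewrite addrC addr_eq0 => /eqP.
have delta_comm_p x : delta x * p = p * delta x.
  have := delta_star (p * x); rewrite starM sp !deltaM delta_p delta_star.
  by rewrite mul0r add0r mulr0 addr0 mulNr => /oppr_inj.
pose q := 1 - p.
have pq0 : p * q = 0 by rewrite mulrBr mulr1 pp subrr.
have delta_q : delta q = 0.
  by apply/commutator_eq0; rewrite /GRing.comm mulrBr mulrBl mulr1 mul1r ds.
have corner0 x : p * delta x * q = 0.
  by rewrite -delta_comm_p -mulrA pq0 mulr0.
have delta_corner x : delta (p * x * q) = 0.
  by rewrite !deltaM delta_p delta_q mul0r mulr0 add0r addr0 corner0.
have delta_mulp y : delta y * p = 0.
  have [x | // | /subr0_eq/esym/p1 //] := R_prime (delta y * p) q.
  have := corner0 (y * (p * x * q)).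
  have qq : q * q = q by rewrite {1}/q mulrBl mul1r pq0 subr0.
  rewrite deltaM delta_corner mulr0 addr0 !mulrA -(mulrA _ q) qq.
  by rewrite -delta_comm_p -(mulrA _ p p) pp.
move=> y; apply/commutator_eq0.
have [x | // | /p0 //] := R_prime (delta y) p.
have := delta_mulp (y * x).
by rewrite deltaM mulrDl -(mulrA y) delta_mulp mulr0 addr0.
Qed.

(** If [x a = x a^*] for all [a], then [x b c = x c^* b = x c b] for symmetric
    [b], by the hypothesis at [b c] and at [c]; so [x] annihilates all
    commutators of [b]. *)
Lemma left_annihilator_of_skew_eq0 (R : starRingType) (b x : R) :
  prime_ring R -> star b = b -> ~ central b ->
  (forall a, x * (a - star a) = 0) -> x = 0.
Proof.
move=> R_prime sb ncb xK0.
have xstar a : x * star a = x * a by have := xK0 a; rewrite mulrBr => /subr0_eq.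
apply: (left_annihilator_of_commutators_eq0 R_prime ncb) => c.
rewrite mulrBr -(xstar (b * c)) starM sb.
by rewrite !mulrA xstar subrr.
Qed.

Lemma skew_commutatorE (R : starRingType) (a b : R) :
  skew_commutator a b = commutator a b + b * (a - star a).
Proof. by rewrite /skew_commutator /commutator mulrBr addrA subrK. Qed.

Lemma star1 (R : starRingType) : star 1 = 1 :> R.
Proof. by have := starM (star 1 : R) 1; rewrite mulr1 starK mulr1. Qed.

Lemma starN (R : starRingType) (x : R) : star (- x) = - star x.
Proof.
have star0 : star 0 = 0 :> R by apply: (addrI (star 0)); rewrite -starD !addr0.
by apply/eqP; rewrite -addr_eq0 -starD addNr star0.
Qed.

(** The first claim comes from the skew commutators of [v] with [b], which are
    those of [1] with [Phi b] and hence vanish; the second from those of [a]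
    with [v], which are those of [Phi a] with [1], namely
    [Phi a - (Phi a)^*]. *)
Lemma preimage_of_one (R : starRingType) (Phi : R -> R) (v : R) :
  strong_skew_commutativity_preserving Phi -> Phi v = 1 ->
  central_symmetric v /\
  (forall a, Phi a - star (Phi a) = v * (a - star a)).
Proof.
move=> hPhi Phiv.
have vE b : v * b = b * star v.
  apply: subr0_eq; rewrite -[LHS]/(skew_commutator v b) -hPhi Phiv.
  by rewrite /skew_commutator star1 mul1r mulr1 subrr.
have sv : star v = v by rewrite -[LHS]mul1r -vE mulr1.
have cv : central v by move=> b; rewrite /GRing.comm vE sv.
split=> // a.
have := hPhi a v; rewrite Phiv /skew_commutator mulr1 mul1r => ->.
by rewrite mulrBr cv.
Qed.

Theorem theorem2p1 (R : starRingType) (R_prime : prime_ring R)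
    (P : R) (hP : nontrivial_symmetric_idempotent P)
    (Phi : R -> R) (Phi_surj : forall y : R, exists x : R, Phi x = y)
    (hPhi : strong_skew_commutativity_preserving Phi) :
  exists f : R -> R,
    (forall a : R, central_symmetric (f a)) /\
    ((forall a : R, Phi a = a + f a) \/ (forall a : R, Phi a = - a + f a)).
Proof.
have [v Phiv] := Phi_surj 1.
have [[cv sv] PhiK] := preimage_of_one hPhi Phiv.
have ncP : ~ central P.
  by case: hP => pp _; apply: nontrivial_idempotent_not_central.
have sP : star P = P by case: hP.
have defect a b : commutator (Phi a) (Phi b) - commutator a b
    = (b - v * Phi b) * (a - star a).
  have := hPhi a b; rewrite !skew_commutatorE PhiK mulrA -(cv (Phi b)).
  move/eqP; rewrite -subr_eq0 opprD addrACA addr_eq0 => /eqP ->.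
  by rewrite opprB -mulrBl.
have vPhi_sym s : star s = s -> v * Phi s = s.
  move=> ss; apply/esym/subr0_eq.
  apply: (left_annihilator_of_skew_eq0 R_prime sP ncP) => a.
  rewrite -defect commutatorC (commutatorC a) -opprD defect.
  by rewrite ss subrr mulr0 oppr0.
have comm_Phi_sym a s : star s = s ->
    commutator (Phi a) s = v * commutator a s.
  move=> ss; have /eqP := defect a s.
  rewrite vPhi_sym // subrr mul0r subr_eq0 => /eqP <-.
  by rewrite -{1}(vPhi_sym s ss) /commutator mulrBr !mulrA (cv (Phi a)).
have vv1 : v * v = 1.
  have [//|vv_neq1] := eqVneq (v * v) 1; case: ncP.
  (* Otherwise [P] would commute with every symmetric element. *)
  apply: (commutes_symmetric_central R_prime hP) => s ss.
  apply/commutator_eq0.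
  have cvv : central (v * v - 1).
    move=> x; rewrite /GRing.comm mulrBl mulrBr mul1r mulr1.
    by rewrite -mulrA (cv x) mulrA cv -mulrA.
  have [|/subr0_eq vv1|//] := central_mul_eq0 (a := commutator P s) R_prime cvv.
    rewrite mulrBl mul1r -mulrA -comm_Phi_sym //.
    rewrite -[X in _ - commutator X _](vPhi_sym P sP).
    by rewrite /commutator mulrBr !mulrA (cv s) subrr.
  by rewrite vv1 eqxx in vv_neq1.
have central_diff a : central_symmetric (Phi a - v * a).
  split.
    apply: (commutes_symmetric_central R_prime hP) => s ss.
    apply/commutator_eq0.
    have /eqP := comm_Phi_sym a s ss; rewrite -subr_eq0 => /eqP <-.
    rewrite /commutator mulrBr mulrBl !mulrBr !mulrA (cv s) !opprB.
    by rewrite addrACA [RHS]addrACA; congr (_ + _); apply: addrC.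
  rewrite starD starN starM sv -cv; apply/esym/subr0_eq.
  by rewrite opprD addrACA PhiK -opprD -mulrBr subrr.
exists (fun a => Phi a - v * a); split=> //.
case: (central_sqr_eq1 R_prime cv vv1) => ->; [left | right] => a.
  by rewrite mul1r addrC subrK.
by rewrite mulN1r opprK addrC addrK.
Qed.
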